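(* Let $i,j,k,l$ be integers with $0<i<k\leq j<l$, and put $r=k-i$, $c=l-j$; assume $r<c<k$. Then for any pair of integers $(p,q)$ with $0<q<p\leq r+1$ the following identity of polynomials in $t$ holds: $$\frac{P_{k-q+1}}{P_{k-p+1}P_{p-q}}=\sum_{u=q+1}^{p-1}\left(\frac{P_{k-c}}{P_{p-u}P_{k-c-p+u}}\cdot\frac{P_{c-q+1}}{P_{u-q}P_{c-u+1}}\cdot t^{2d_{pu}}\right)+\frac{P_{k-c}}{P_{p-q}P_{k-c-p+q}}\cdot t^{2d_{pq}}+\frac{P_{c-q+1}}{P_{p-q}P_{c-p+1}},$$ where $d_{pu}=(p-u)(c+1-u)$ for all integers $u$ with $0<u<p$.
   Context: For an integer $\alpha\geq 0$ put $h_\alpha=\sum_{m=0}^{\alpha}t^{2m}$; put $P_0=1$ and $P_\alpha=h_0h_1\cdots h_{\alpha-1}$ for $\alpha>0$. For integers $n\ge 0$ and $m$ with $0\le m\le n$, $\frac{P_n}{P_mP_{n-m}}$ is a polynomial in $t$, namely the Poincaré polynomial (of rational cohomology) of the Grassmannian of $m$-dimensional subspaces of $\mathbb{C}^n$. A fraction $\frac{P_n}{P_mP_{n-m}}$ with $m>n$, i.e. in which $P_{n-m}$ has negative index, is by convention $0$ (the corresponding Grassmannian is empty). An empty sum is $0$. *)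

(* Defs.v *)
From mathcomp Require Import all_boot all_order all_algebra.

Set Implicit Arguments.
Unset Strict Implicit.
Unset Printing Implicit Defensive.

Import GRing.Theory.
Local Open Scope ring_scope.

(* The variable t is 'X : {poly int}. *)
Definition h (a : nat) : {poly int} := \sum_(0 <= m < a.+1) 'X^(2 * m).

Definition P (a : nat) : {poly int} := \prod_(0 <= b < a) h b.

(* The fraction P_n / (P_m P_{n-m}), in the field of fractions of Z[t], with
   the convention that it vanishes when the index n - m is negative. *)
Definition grass (n m : nat) : {fraction {poly int}} :=
  if (m <= n)%N then tofrac (P n) / (tofrac (P m) * tofrac (P (n - m))) else 0.

(* Only used for u < p <= c, where both subtractions are exact. *)
Definition d (c p u : nat) : nat := ((p - u) * (c + 1 - u))%N.

Lemma hD (a b : nat) : h (a + b).+1 = h a + 'X^(2 * a.+1) * h b.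
Proof.
rewrite /h (big_cat_nat (n := a.+1)) //=; last by rewrite ltnS leqW ?leq_addr.
congr (_ + _); rewrite -{1}[a.+1]add0n big_addn.
rewrite (_ : ((a + b).+2 - a.+1 = b.+1)%N); last by rewrite -addSn -addnS addKn.
by rewrite mulr_sumr; apply: eq_bigr => m _; rewrite -exprD -mulnDr addnC.
Qed.

Lemma PS (a : nat) : P a.+1 = P a * h a.
Proof. by rewrite /P big_nat_recr. Qed.

Lemma P_neq0 (a : nat) : P a != 0.
Proof.
have h0 b : (h b).[0] = 1.
  rewrite /h big_nat_recl // hornerD horner_sum big1 ?addr0 ?hornerXn // => m _.
  by rewrite hornerXn mulnS expr0n.
suff E : (P a).[0] = 1 by apply/eqP => P0; move: E; rewrite P0 horner0.
by rewrite /P horner_prod big1.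
Qed.

Lemma P_dvd (a b : nat) : exists x, P (a + b) = x * (P a * P b).
Proof.
have P0 : P 0 = 1 by rewrite /P big_nil.
have [n] := ubnP (a + b); elim: n a b => // n IHn [|a] [|b] ltn.
- by exists 1; rewrite P0 !mul1r.
- by exists 1; rewrite P0 !mul1r.
- by exists 1; rewrite P0 addn0 mulr1 mul1r.
have [x Ex] : exists x, P (a + b.+1) = x * (P a * P b.+1) by apply: IHn.
have [y Ey] : exists y, P (a.+1 + b) = y * (P a.+1 * P b).
  by apply: IHn; rewrite -ltnS -addnS.
exists (x + 'X^(2 * a.+1) * y).
rewrite addSn PS addnS hD mulrDr -{1}addnS Ex -addSn.
rewrite [P (a.+1 + b) * _]mulrCA Ey !PS mulrDl.
congr (_ + _); last by rewrite -!mulrA.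
by rewrite -!mulrA; do 2 congr (_ * _); rewrite mulrA mulrC.
Qed.

(* [grass n m] is a polynomial, so by injectivity of [tofrac] an equation
   between such fractions is an identity in {poly int}. *)
Lemma grass_poly (n m : nat) : exists x : {poly int}, grass n m = tofrac x.
Proof.
rewrite /grass; case: leqP => [lemn|_]; last by exists 0; rewrite rmorph0.
have [x] := P_dvd m (n - m); rewrite subnKC // => ->; exists x.
by rewrite !rmorphM /= mulfK // mulf_neq0 // tofrac_eq0 P_neq0.
Qed.

(* Main.v *)
Require Import Defs.
From mathcomp Require Import all_boot all_order all_algebra.
From mathcomp Require Import zify ring.

Import GRing.Theory.
Local Open Scope ring_scope.

(** The fraction [grass n m] is the Gaussian binomial coefficient
    [n choose m] in the variable [y := t^2], because [h a] is the [y]-integer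
    [1 + y + ... + y^a] and [P a] is the [y]-factorial of [a].  With
    [a := k - c], [b := c - q + 1] and [s := p - q], the identity is then the
    Gaussian form of Vandermonde's convolution,
      [a + b choose s] = sum over v <= s of
                         y^((s - v)(b - v)) [a choose s - v] [b choose v],
    read with [v := u - q]: the terms [v = 0] and [v = s] are the two isolated
    summands, in which one of the two coefficients is 1, and the left-hand side
    comes from [k - p + 1 = (a + b) - s] and the symmetry [grass_sub].

    The convolution ([grass_vandermonde]) is proved by induction on [b] from
    Pascal's rule ([grass_pascal]),
      [n + 1 choose m + 1] = [n choose m] + y^(m + 1) [n choose m + 1].
    Applied to [b + 1 choose v], the rule splits the sum into two convolutions
    for [b], which are the two terms that it gives for [a + b + 1 choose s]. *)

Local Notation y := (tofrac ('X^2 : {poly int})).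

Lemma tofrac_Xn2 (n : nat) : tofrac ('X^(2 * n) : {poly int}) = y ^+ n.
Proof. by rewrite exprM rmorphXn. Qed.

Lemma tofracP_neq0 (a : nat) : tofrac (P a) != 0.
Proof. by rewrite tofrac_eq0 P_neq0. Qed.

Lemma tofrach_neq0 (a : nat) : tofrac (h a) != 0.
Proof.
by move: (tofracP_neq0 a.+1); rewrite PS rmorphM /= mulf_eq0 negb_or => /andP[].
Qed.

Lemma tofracPS (a : nat) : tofrac (P a.+1) = tofrac (P a) * tofrac (h a).
Proof. by rewrite PS rmorphM. Qed.

Lemma tofrac_hD (a b : nat) :
  tofrac (h (a + b).+1) = tofrac (h a) + y ^+ a.+1 * tofrac (h b).
Proof. by rewrite hD rmorphD rmorphM /= tofrac_Xn2. Qed.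

Lemma P0 : P 0 = 1.
Proof. by rewrite /P big_nil. Qed.

Lemma grass0 (n : nat) : grass n 0 = 1.
Proof. by rewrite /grass leq0n subn0 P0 rmorph1 mul1r divff ?tofracP_neq0. Qed.

Lemma grass_diag (n : nat) : grass n n = 1.
Proof. by rewrite /grass leqnn subnn P0 rmorph1 mulr1 divff ?tofracP_neq0. Qed.

Lemma grass_gt (n m : nat) : (n < m)%N -> grass n m = 0.
Proof. by rewrite /grass ltnNge => /negbTE->. Qed.

Lemma grass_sub (n m : nat) : (m <= n)%N -> grass n (n - m) = grass n m.
Proof. by move=> lemn; rewrite /grass leq_subr lemn subKn // [X in _ / X]mulrC. Qed.

(** The identity of fractions behind Pascal's rule, with [x = P n], [a = P m],
    [b = P (n - m - 1)], and [ha], [hb] the [y]-integers that extend the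
    factorials [a], [b] by one step.  The field is arbitrary so that normalisation
    treats these values as atoms and does not compute with polynomials. *)
Lemma pascal_fraction (F : fieldType) (x a ha b hb z : F) :
  a != 0 -> ha != 0 -> b != 0 -> hb != 0 ->
  x * (ha + z * hb) / (a * ha * (b * hb))
  = x / (a * (b * hb)) + z * (x / (a * ha * b)).
Proof. by move=> a0 ha0 b0 hb0; field; rewrite a0 ha0 b0 hb0. Qed.

(** For [m < n] both sides have the common denominator
    [P (m + 1) P (n - m)], and the numerators agree by
    [h n = h m + y^(m + 1) h (n - m - 1)], which cuts the [y]-integer [h n]
    after its first [m + 1] terms. *)
Lemma grass_pascal (n m : nat) :
  grass n.+1 m.+1 = grass n m + y ^+ m.+1 * grass n m.+1.
Proof.
case: (ltngtP m n) => [ltmn|ltnm|->]; last 2 first.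
- by rewrite !grass_gt ?mulr0 ?addr0 // ltnS ltnW.
- by rewrite !grass_diag grass_gt // mulr0 addr0.
rewrite /grass ltnS (ltnW ltmn) ltmn subSS.
have [b ->] : exists b, n = (m + b).+1 by exists (n - m.+1)%N; lia.
rewrite -addnS addKn addnS subSS addKn !tofracPS tofrac_hD.
by rewrite pascal_fraction ?tofracP_neq0 ?tofrach_neq0.
Qed.

(** The truncated difference [b - v] is harmless: [grass b v] vanishes
    when [b < v]. *)
Lemma grass_vandermonde (a b s : nat) :
  grass (a + b) s =
    \sum_(0 <= v < s.+1) grass a (s - v) * grass b v * y ^+ ((s - v) * (b - v)).
Proof.
elim: b s => [|b IHb] s.
  rewrite addn0 big_nat_recl // subn0 grass0 muln0 mulr1 expr0 mulr1.
  rewrite big1 ?addr0 // => v _.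
  by rewrite (grass_gt 0) // mulr0 mul0r.
case: s => [|s]; first by rewrite big_nat1 !grass0 !mulr1.
rewrite addnS grass_pascal !IHb [RHS]big_nat_recl // [X in _ + _ * X = _]big_nat_recl //.
rewrite mulrDr addrCA; congr (_ + _).
  by rewrite !subn0 !grass0 !mulr1 mulnS exprD mulrCA.
rewrite mulr_sumr -big_split; apply: eq_big_nat => v /andP[_ ltvs] /=.
rewrite !subSS grass_pascal mulrDr mulrDl; congr (_ + _).
have [ltbv|lebv] := ltnP b v.+1; first by rewrite (grass_gt b) // !(mulr0, mul0r).
(* Lowering b + 1 to b takes s - v off the exponent; with the v + 1 of Pascal's
   rule this makes s + 1, independently of v, so the power leaves the sum. *)
have E : y ^+ ((s - v) * (b - v)) * y ^+ v.+1
         = y ^+ s.+1 * y ^+ ((s - v) * (b - v.+1)).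
  rewrite -!exprD; congr (_ ^+ _).
  by rewrite -(subnSK lebv) mulnS; lia.
by rewrite mulrCA -E [y ^+ v.+1 * grass _ _]mulrC !mulrA [RHS]mulrAC.
Qed.

Theorem theorem3p1 (i j k l r c p q : nat)
  (hi : (0 < i)%N) (hik : (i < k)%N) (hkj : (k <= j)%N) (hjl : (j < l)%N)
  (hr : r = (k - i)%N) (hc : c = (l - j)%N)
  (hrc : (r < c)%N) (hck : (c < k)%N)
  (hq : (0 < q)%N) (hqp : (q < p)%N) (hp : (p <= r + 1)%N) :
  grass (k - q + 1) (k - p + 1) =
    (\sum_(q.+1 <= u < p)
       (grass (k - c) (p - u) * grass (c - q + 1) (u - q)
          * tofrac 'X^(2 * d c p u)))
    + grass (k - c) (p - q) * tofrac 'X^(2 * d c p q)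
    + grass (c - q + 1) (p - q).
Proof.
have -> : (k - p + 1 = k - q + 1 - (p - q))%N by lia.
rewrite grass_sub; last by lia.
have -> : (k - q + 1 = k - c + (c - q + 1))%N by lia.
have Ed u : (q <= u)%N -> d c p u = ((p - q - (u - q)) * (c - q + 1 - (u - q)))%N.
  by move=> lequ; rewrite /d; congr (_ * _)%N; lia.
rewrite grass_vandermonde big_nat_recr //= subnn grass0 mul1r mul0n expr0 mulr1.
congr (_ + _); rewrite big_ltn ?subn_gt0 // addrC; congr (_ + _); last first.
  by rewrite tofrac_Xn2 Ed // subnn !subn0 grass0 mulr1.
rewrite -[q.+1]add1n big_addn; apply: eq_big_nat => v _.
by rewrite tofrac_Xn2 Ed ?leq_addl // addnK [(v + q)%N]addnC subnDA.
Qed.
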